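(* Let $G$ be a finite, simple, undirected, connected graph of order $n\ge 2$. Then $$\mathrm{bf}(G)\le \left\lfloor \frac{2}{5}(n-1) \right\rfloor.$$ Moreover, if $\mathrm{bf}(G) = \left\lfloor\frac{2}{5}(n-1)\right\rfloor$ and $n \equiv 1$ or $4 \pmod{5}$, then $G$ has a unique metric basis.
   Context: For vertices $u,v$ of a connected graph $G$, $d_G(u,v)$ is the number of edges in a shortest $u$–$v$ path. A vertex $x$ resolves two vertices $u,v$ if $d_G(u,x)\neq d_G(v,x)$. A set $R\subseteq V(G)$ is a resolving set of $G$ if every pair of distinct vertices of $G$ is resolved by some vertex of $R$. A metric basis of $G$ is a resolving set of smallest possible cardinality. A basis forced vertex of $G$ is a vertex that belongs to every metric basis of $G$; $\mathrm{bf}(G)$ denotes the number of basis forced vertices of $G$. The order of $G$ is $|V(G)|$. *)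

(* Defs.v *)
From mathcomp Require Import all_boot.

Set Implicit Arguments.
Unset Strict Implicit.
Unset Printing Implicit Defensive.

Section MetricBasis.

Variables (T : finType) (e : rel T).
Implicit Types (u v x : T) (R S : {set T}).

Definition simple_graph : Prop := symmetric e /\ irreflexive e.

Definition connected_graph : Prop := forall u v, connect e u v.

Definition has_path u v (k : nat) : bool :=
  [exists p : k.-tuple T, [&& path e u p, uniq (u :: p) & last u p == v]].

(* The least k such that has_path u v k. A path has pairwise distinct vertices,
   hence fewer than #|T| edges, so searching k < #|T| is exhaustive; the value
   is #|T| when there is no path from u to v. *)
Definition gdist u v : nat := find (has_path u v) (iota 0 #|T|).

Definition resolves x u v : bool := gdist u x != gdist v x.

Definition resolving_set R : bool :=
  [forall u, forall v, (u != v) ==> [exists x in R, resolves x u v]].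

Definition metric_basis R : bool :=
  resolving_set R && [forall S, resolving_set S ==> (#|R| <= #|S|)].

Definition basis_forced x : bool := [forall R, metric_basis R ==> (x \in R)].

Definition bf : nat := #|[set x | basis_forced x]|.

Lemma has_path_lt u v k : has_path u v k -> k < #|T|.
Proof.
case/existsP=> p /and3P[_ /card_uniqP Up _].
by rewrite -(size_tuple p) -[(size p).+1]/(size (u :: p)) -Up max_card.
Qed.

Lemma gdist_min u v k : has_path u v k -> gdist u v <= k.
Proof.
move=> uvk; rewrite leqNgt; apply/negP=> /(before_find 0).
by rewrite nth_iota ?(has_path_lt uvk) // add0n uvk.
Qed.

Lemma gdist_path u v : connect e u v -> has_path u v (gdist u v).
Proof.
case/connectP=> q /shortenP[p ep Up _] vE.
have uvp : has_path u v (size p).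
  by apply/existsP; exists (in_tuple p); rewrite ep Up vE eqxx.
have hs : has (has_path u v) (iota 0 #|T|).
  by apply/hasP; exists (size p); rewrite ?mem_iota ?(has_path_lt uvp).
have := nth_find 0 hs; rewrite nth_iota ?add0n //.
by move: hs; rewrite has_find size_iota.
Qed.

End MetricBasis.

(* Main.v *)
Require Import Defs.
From mathcomp Require Import all_boot zify.

Set Implicit Arguments.
Unset Strict Implicit.
Unset Printing Implicit Defensive.

(** Let [R] be a metric basis and encode every vertex outside [R] by its
    distances to [R]; these codes are distinct.  Say that two vertices outside
    [R] form an edge of colour [f] when [f] is the only element of [R]
    separating them.  If [f] is basis forced then no exchange of [f] for another
    vertex gives a resolving set, and this yields at least two edges of colour
    [f].  On the other hand, [m] distinct codes with [k] colours
    having at least two edges each satisfy [3 * k <= 2 * (m - 1)], by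
    induction on [m], splitting the codes along one coordinate.  Since
    [n = #|R| + m] with [#|R| >= k], this gives [5 * k <= 2 * (n - 1)], and
    in the residue classes 1 and 4 equality forces [#|R| = k]. *)

(** * Edge-coloured graphs on codes and the weighted counting bound *)

Section CodeGraph.

Variables (T I : finType) (c : I -> T -> nat).
Implicit Types (X Y : {set T}) (f g : I).

Definition only_sep f x y :=
  (c f x != c f y) && [forall g, (g != f) ==> (c g x == c g y)].

Definition code_edges f X : {set T * T} :=
  [set p | [&& p.1 \in X, p.2 \in X & only_sep f p.1 p.2]].

(* Edges are ordered pairs, so the weight is 0, 2 or 3 when there are
   respectively no, one, or several unordered edges. *)
Definition weight f X := minn 3 #|code_edges f X|.

Definition separated X :=
  {in X &, forall x y, (forall i, c i x = c i y) -> x = y}.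

Lemma only_sepP f x y :
  reflect (c f x <> c f y /\ forall g, g != f -> c g x = c g y)
          (only_sep f x y).
Proof.
apply: (iffP andP) => [[/eqP ? /forallP h]|[/eqP ? h]]; split=> //.
  by move=> g gf; have /implyP/(_ gf)/eqP := h g.
by apply/forallP=> g; apply/implyP=> /h ->.
Qed.

Lemma only_sep_sym f x y : only_sep f x y = only_sep f y x.
Proof.
by apply/only_sepP/only_sepP=> -[h1 h2]; split=> [|g /h2 //]; apply/nesym.
Qed.

Lemma weight_gt0 f X : 0 < weight f X -> 2 <= weight f X.
Proof.
rewrite /weight leq_min => /andP[_ /card_gt0P[[x y] xy]].
rewrite leq_min /=; apply/card_gt1P; exists (x, y), (y, x).
have := xy; rewrite !inE /= => /and3P[-> -> s]; rewrite (only_sep_sym f y x) s.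
split=> //; apply/eqP=> -[yx _].
by case/only_sepP: s; rewrite yx.
Qed.

(** Ends of an edge of colour [g] agree at [f], so cutting along [f] never cuts the edge; truncation
    at 3 is subadditive. *)
Lemma weight_split f g a X (A := [set z in X | c f z == a]) :
  g != f -> weight g X <= weight g A + weight g (X :\: A).
Proof.
move=> gf; suff : #|code_edges g X| <= #|code_edges g A| + #|code_edges g (X :\: A)|.
  rewrite /weight; lia.
apply: leq_trans (leq_card_setU _ _); apply/subset_leq_card/subsetP=> -[x y].
rewrite !inE /= => /and3P[xX yX s]; rewrite xX yX s /=.
case/only_sepP: s => _ /(_ f); rewrite eq_sym => /(_ gf) ->.
by case: eqP.
Qed.

(** Colours with a single edge also count, with weight 2: a cut can leave one edge of a colour on
    each side, so a bound on the colours of weight 3 alone would not pass through the induction. *)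
Definition weight_bound X := X != set0 -> \sum_f weight f X + 2 <= 2 * #|X|.

Lemma sum_weight_split f a X (A := [set z in X | c f z == a]) :
  \sum_(g | g != f) weight g X
  <= \sum_(g | g != f) weight g A + \sum_(g | g != f) weight g (X :\: A).
Proof. by rewrite -big_split /=; apply: leq_sum => g; exact: weight_split. Qed.

Lemma card_split f x y X (A := [set z in X | c f z == c f x]) :
    x \in X -> y \in X -> c f x <> c f y ->
  [/\ x \in A, y \in X :\: A, A \proper X, X :\: A \proper X
    & #|X| = #|A| + #|X :\: A|].
Proof.
move=> xX yX xy.
have xA : x \in A by rewrite inE xX eqxx.
have yA : y \notin A by rewrite inE yX /=; apply/eqP/nesym.
have AX : A \subset X by apply/subsetP=> z; rewrite inE => /andP[].
split=> //; first by rewrite inE yA.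
- by apply/properP; split=> //; exists y.
- by apply/properP; split; [exact: subsetDl | exists x; rewrite ?inE ?xX ?eqxx].
- by rewrite -(cardsID A X) (setIidPr AX).
Qed.

(** Both sides of the cut are nonempty and each bound has slack 2, so adding them leaves slack 4
    once colour [f] is left out. *)
Lemma weight_bound_off f x y X :
    (forall Y, Y \proper X -> weight_bound Y) ->
    x \in X -> y \in X -> c f x <> c f y ->
  \sum_(g | g != f) weight g X + 4 <= 2 * #|X|.
Proof.
move=> IH xX yX xy; have [] := card_split xX yX xy.
have /= := sum_weight_split f (c f x) X.
set A := [set z in X | _] => le_sum xA yB AX BX cX.
have bound Y z : Y \proper X -> z \in Y -> \sum_(g | g != f) weight g Y + 2 <= 2 * #|Y|.
  move=> YX zY; have := IH Y YX; rewrite /weight_bound.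
  have -> : Y != set0 by apply/set0Pn; exists z.
  by rewrite (bigD1 f) //= => /(_ isT); lia.
by have := bound A x AX xA; have := bound (X :\: A) y BX yB; lia.
Qed.

(** Strong induction on [#|X|], cutting along a colour [f] that has an edge. Slack 4 from the cut
    pays for weight 2 of [f]; for weight 3 one more unit has to be found on the two sides. *)
Lemma sum_weight_bound X : separated X -> weight_bound X.
Proof.
have [n] := ubnP #|X|; elim: n X => // n IHn X /ltnSE leXn sepX X0.
have IH Y : Y \proper X -> weight_bound Y.
  move=> YX; apply: IHn; first exact: leq_trans (proper_card YX) leXn.
  have /subsetP YsX := proper_sub YX.
  by move=> x y /YsX xX /YsX yX; exact: sepX.
have [/existsP[f wf]|/existsPn w0] := boolP [exists f, 0 < weight f X]; last first.
  rewrite big1 => [|f _]; first by have := X0; rewrite -card_gt0; lia.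
  by apply/eqP; rewrite -leqn0 leqNgt.
have /card_gt0P[[a b]] : 0 < #|code_edges f X| by have := wf; rewrite /weight; lia.
rewrite inE /= => /and3P[aX bX sab]; have [fab gab] := only_sepP _ _ _ sab.
have off := weight_bound_off IH aX bX fab.
rewrite (bigD1 f) //=.
have [w2|w3] := leqP (weight f X) 2; first by move: off w2; lia.
have [] := card_split aX bX fab; have /= := sum_weight_split f (c f a) X.
have wsplit g : g != f -> _ := @weight_split f g (c f a) X.
set A := [set z in X | _] in wsplit *; set B := X :\: A in wsplit *.
move=> le_sum aA bB Aprop Bprop cX.
have wX3 g Y : weight g Y <= 3 by rewrite /weight geq_minl.
have bA : \sum_g weight g A + 2 <= 2 * #|A| by apply: IH => //; apply/set0Pn; exists a.
have bB' : \sum_g weight g B + 2 <= 2 * #|B| by apply: IH => //; apply/set0Pn; exists b.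
have IHA Y : Y \proper A -> weight_bound Y.
  by move=> YA; apply: IH; apply: proper_trans YA Aprop.
have IHB Y : Y \proper B -> weight_bound Y.
  by move=> YB; apply: IH; apply: proper_trans YB Bprop.
have sumD1 h Y : \sum_g weight g Y = weight h Y + \sum_(g | g != h) weight g Y.
  by rewrite (bigD1 h).
have fA := sumD1 f A; have fB := sumD1 f B.
(* An edge of colour [f] inside [B] is paid for in the bound for [B] but absent from the sum over
   the other colours, which frees at least 2 units. *)
have [wB|/weight_gt0 wB] := posnP (weight f B); last by have := wX3 f X; lia.
have noB x y : x \in B -> y \in B -> only_sep f x y = false.
  move=> xB yB; apply/negP=> s.
  have : 0 < weight f B.
    by rewrite /weight leq_min /=; apply/card_gt0P; exists (x, y); rewrite inE /= xB yB.
  by rewrite wB.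
(* All [f]-edges now run between [A] and [B]. A second one cannot share the end [a]: its end in [B]
   would differ from [b] at [f] only, giving an [f]-edge inside [B]. *)
have [a' [b' [a'A b'B sab' aa']]] :
    exists a' b', [/\ a' \in A, b' \in B, only_sep f a' b' & a <> a'].
  have : 2 < #|code_edges f X| by move: w3; rewrite /weight; lia.
  have c2 : #|[set (a, b); (b, a)]| <= 2 by rewrite cards2; case: (_ != _).
  move=> c3; have /subsetPn[[x y]] : ~~ (code_edges f X \subset [set (a, b); (b, a)]).
    by apply/negP=> /subset_leq_card; rewrite leqNgt (leq_ltn_trans c2 c3).
  rewrite !inE !xpair_eqE negb_or /= => /and3P[xX yX sxy] nxy.
  wlog xA : x y xX yX sxy nxy / x \in A.
    move=> W; have [/(W x y) //|xA] := boolP (x \in A); first exact.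
    have [yA|yA] := boolP (y \in A).
      by apply: (W y x) => //; [rewrite only_sep_sym | move: nxy; do 4!case: (_ == _)].
    by have := noB x y; rewrite !in_setD xA xX yA yX sxy => /(_ isT isT).
  have yB : y \in B.
    rewrite in_setD yX andbT; apply/negP; move: xA; rewrite !inE xX yX /=.
    by move=> /eqP xa /eqP ya; case/only_sepP: sxy; rewrite xa ya.
  exists x, y; split=> // ax; case/andP: nxy; rewrite -ax eqxx /= => /eqP yb _.
  apply: yb; case/only_sepP: sxy => _; rewrite -ax => gay.
  have gyb g : g != f -> c g y = c g b by move=> gf; rewrite -gay // gab.
  apply: sepX => // g; have [->|/gyb //] := eqVneq g f.
  apply/eqP; apply: contraFT (noB _ _ yB bB) => /eqP fyb; exact/only_sepP.
have [_ gab'] := only_sepP _ _ _ sab'.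
have a'X : a' \in X by move: a'A; rewrite inE => /andP[].
(* The two [f]-edges are parallel: a coordinate [g] separating [a] from [a'] also separates [b] from
   [b'], so [g] varies on both sides. *)
have [/existsP[g /eqP gaa']|/existsPn eqaa'] := boolP [exists g, c g a != c g a']; last first.
  by case: aa'; apply: sepX => // g; apply/eqP; have := eqaa' g; rewrite negbK.
have gf : g != f.
  by apply: contra_notN gaa' => /eqP ->; move: a'A; rewrite inE => /andP[_ /eqP].
have gbb' : c g b <> c g b' by rewrite -gab // -gab'.
(* If [g] has no edge on one side, cutting that side along [g] gives it slack 4 instead of 2. *)
have [wgA|/weight_gt0 wgA] := posnP (weight g A).
  move: (weight_bound_off IHA aA a'A gaa') (sumD1 g A) (wX3 f X).
  clear -cX le_sum bB' fA fB wgA; lia.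
have [wgB|/weight_gt0 wgB] := posnP (weight g B).
  move: (weight_bound_off IHB bB b'B gbb') (sumD1 g B) (wX3 f X).
  clear -cX le_sum bA fA fB wgB; lia.
(* Otherwise [g] weighs at least 2 on each side but at most 3 on [X]: the truncation saves the
   missing unit. *)
rewrite fA in bA; rewrite fB in bB'.
rewrite [\sum_(h | h != f) weight h X](bigD1 g) //=.
rewrite [\sum_(h | h != f) weight h A](bigD1 g) //= in bA.
rewrite [\sum_(h | h != f) weight h B](bigD1 g) //= in bB'.
have : \sum_(h | (h != f) && (h != g)) weight h X <=
       \sum_(h | (h != f) && (h != g)) weight h A +
       \sum_(h | (h != f) && (h != g)) weight h B.
  by rewrite -big_split; apply: leq_sum => h /andP[hf _]; exact: wsplit.
move: (wX3 f X) (wX3 g X); clear -cX bA bB' wgA wgB; lia.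
Qed.

End CodeGraph.

(** * Distances, resolving sets and basis forced vertices *)

Section ForcedVertices.

Variables (T : finType) (e : rel T).
Hypothesis sym_e : symmetric e.
Implicit Types (u v x f : T) (R S : {set T}).

Lemma gdist_eq0 u v : (gdist e u v == 0) = (u == v).
Proof.
have T0 : 0 < #|T| by apply/card_gt0P; exists u.
rewrite /gdist -(prednK T0) /=.
suff -> : has_path e u v 0 = (u == v) by case: (u == v).
apply/existsP/eqP=> [[p]|->]; last by exists [tuple]; rewrite /= eqxx.
by rewrite (tuple0 p) /= => /eqP.
Qed.

Lemma has_path_sym u v k : has_path e u v k = has_path e v u k.
Proof.
suff h x y : has_path e x y k -> has_path e y x k by apply/idP/idP; exact: h.
case/existsP=> p /and3P[ep Up /eqP py]; apply/existsP.
have sz : size (rev (belast x p)) == k by rewrite size_rev size_belast size_tuple.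
have rE : last x p :: rev (belast x p) = rev (x :: p).
  by rewrite -rev_rcons -lastI.
have lE (s : seq T) : last (last x s) (rev (belast x s)) == x.
  by case: s => //= z s; rewrite rev_cons last_rcons.
exists (Tuple sz); apply/and3P; rewrite -py [val _]/=; split.
- by rewrite rev_path (eq_path (e' := e)) // => ? ?; exact: sym_e.
- by rewrite rE rev_uniq.
- exact: lE.
Qed.

Lemma gdist_sym u v : gdist e u v = gdist e v u.
Proof. by apply: eq_find => k; exact: has_path_sym. Qed.

Lemma resolving_setP R :
  reflect (forall u v, {in R, forall r, gdist e u r = gdist e v r} -> u = v)
          (resolving_set e R).
Proof.
apply: (iffP forallP) => [h u v uv|h u].
  apply/eqP; have /forallP/(_ v)/implyP := h u; case: eqP => // _ /(_ isT).
  by case/existsP=> r /andP[rR]; rewrite /resolves uv ?eqxx.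
apply/forallP=> v; apply/implyP; apply: contra_neqT => /existsPn nr.
apply: h => r rR; apply/eqP; have := nr r.
by rewrite rR /resolves /= negbK.
Qed.

Lemma resolving_setPn R :
  ~~ resolving_set e R ->
  exists u v, u <> v /\ {in R, forall r, gdist e u r = gdist e v r}.
Proof.
case/forallPn=> u /forallPn[v]; rewrite negb_imply => /andP[/eqP uv /existsPn nr].
exists u, v; split=> // r rR; apply/eqP; have := nr r.
by rewrite rR /resolves /= negbK.
Qed.

Lemma exists_metric_basis : exists R, metric_basis e R.
Proof.
have rT : resolving_set e setT.
  apply/resolving_setP=> u v /(_ v (in_setT v)) /eqP; rewrite eq_sym.
  by rewrite (eqP (etrans (gdist_eq0 v v) (eqxx v))) eq_sym gdist_eq0 => /eqP.
case: (arg_minnP (fun R : {set T} => #|R|) rT) => R rR minR.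
by exists R; rewrite /metric_basis rR; apply/forallP=> S; apply/implyP=> /minR.
Qed.

(** Coordinates are indexed by all vertices; the constant 0 off [R] ensures that only elements of
    [R] can separate or be colours of edges. *)
Definition code R i x := if i \in R then gdist e x i else 0.

Lemma separated_code R X : resolving_set e R -> separated (code R) X.
Proof.
move=> /resolving_setP rR x y _ _ xy; apply: rR => r rR.
by have := xy r; rewrite /code rR.
Qed.

(** The exchanged set is no larger than [R] and avoids [f]; were it resolving, it would be a metric
    basis without [f]. *)
Lemma exchange_unresolved R f x :
    metric_basis e R -> basis_forced e f -> x <> f ->
  exists u v, [/\ u <> v, {in R :\ f, forall r, gdist e u r = gdist e v r}
                & gdist e u x = gdist e v x].
Proof.
move=> bR /forallP fF xf.
have fR : f \in R by have /implyP := fF R; apply.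
have /resolving_setPn[u [v [uv h]]] : ~~ resolving_set e (x |: R :\ f).
  apply/negP=> rS; suff : f \in x |: R :\ f.
    by rewrite !inE eqxx orbF => /eqP/esym.
  apply: (implyP (fF _)); rewrite /metric_basis rS; apply/forallP=> S; apply/implyP=> rS'.
  case/andP: bR => _ /forallP/(_ S)/implyP/(_ rS'); apply: leq_trans.
  by rewrite cardsU1 (cardsD1 f R) fR; case: (_ \notin _).
exists u, v; split=> [//|r rR|]; apply: h; first by rewrite in_setU rR orbT.
by rewrite !inE eqxx.
Qed.

(** A pair left unresolved by an exchange is an edge of colour [f] unless it contains [f] itself.
    Two distinct partners of [f] again form such an edge, and trying suitable replacements yields
    two edges. *)
Lemma forced_weight R f :
  1 < #|T| -> metric_basis e R -> basis_forced e f -> weight (code R) f (~: R) = 3.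
Proof.
move=> T2 bR fF; have ex := exchange_unresolved bR fF.
have fR : f \in R by have /forallP/(_ R)/implyP := fF; apply.
have /resolving_setP rR : resolving_set e R by case/andP: bR.
set E := code_edges (code R) f (~: R).
pose unres u v := u <> v /\ {in R :\ f, forall r, gdist e u r = gdist e v r}.
have usym u v : unres u v -> unres v u.
  by move=> [uv h]; split=> [|r /h //]; apply/nesym.
have utrans u v w : u <> w -> unres u v -> unres v w -> unres u w.
  by move=> uw [_ h] [_ h']; split=> // r rR'; rewrite h // h'.
have dxx x : gdist e x x = 0 by apply/eqP; rewrite gdist_eq0.
have unresl u v : unres u v -> u != f -> u \in ~: R.
  move=> [uv h] uf; rewrite inE; apply/negP=> uR; apply: uv; apply/eqP.
  by rewrite eq_sym -gdist_eq0 -h ?dxx // in_setD1 uf.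
have resf u v : unres u v -> gdist e u f <> gdist e v f.
  move=> [uv h] euv; apply: uv; apply: rR => r rR'.
  by have [-> //|rf] := eqVneq r f; apply: h; rewrite in_setD1 rf.
have unresE u v : u != f -> v != f -> unres u v -> (u, v) \in E.
  move=> uf vf uv; rewrite inE /= (unresl u v) // (unresl v u) //; last exact: usym.
  apply/only_sepP; split=> [|g gf]; rewrite /code ?fR; first exact: resf.
  by case: ifP => // gR; case: uv => _; apply; rewrite in_setD1 gf.
(* The pair is ordered so that its first vertex is not [f]; neither vertex is [x], since distance 0
   to [x] would make them equal. *)
have step x : x != f -> exists u v, [/\ unres u v, gdist e u x = gdist e v x, u != f & u != x].
  move=> xf; have [u [v [uv h hx]]] := ex x (elimN eqP xf).
  have neqx y z : y <> z -> gdist e y x = gdist e z x -> y != x.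
    move=> yz yzx; apply/eqP=> yx; apply: yz; apply/esym/eqP.
    by rewrite -gdist_eq0 yx -yzx yx dxx.
  have [uf|uf] := eqVneq u f; last by exists u, v; split=> //; apply: neqx uv hx.
  exists v, u; split=> //; first exact: usym.
    by apply: contra_not_neq uv => ->.
  by apply: neqx (esym hx); apply/nesym.
have [E3|E2] := ltnP 2 #|E|; first by apply/minn_idPl.
(* At most one unordered edge: its two ends and the possible partner of [f]
   are all candidates to replace [f]. *)
exfalso.
(* Without edges every unresolved pair contains [f]. Exchanging [f] for its partner [u] gives a
   second partner [u'], and [u'], [u] form an edge. *)
have /card_gt0P[[v w] vwE] : 0 < #|E|.
  rewrite lt0n; apply/eqP => E0; have {}E0 p : p \in E = false by rewrite (cards0_eq E0) inE.
  have [x xf] : exists x, x != f.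
    have /card_gt1P[x [y [_ _ xy]]] := T2.
    by have [xf|] := eqVneq x f; [exists y; rewrite -xf eq_sym | exists x].
  have [u [y [uy _ uf _]]] := step x xf.
  have [yf|yf] := eqVneq y f; last by have := unresE _ _ uf yf uy; rewrite E0.
  have [u' [y' [uy' _ uf' uu']]] := step u uf.
  have [yf'|yf'] := eqVneq y' f; last by have := unresE _ _ uf' yf' uy'; rewrite E0.
  have : unres u' u by apply: utrans uy' _; [apply/eqP | rewrite yf' -yf; apply: usym].
  by move/(unresE _ _ uf' uf); rewrite E0.
have := vwE; rewrite inE /= => /and3P[vR wR /only_sepP[]]; rewrite /code fR => fvw gvw.
have vf : v != f by apply: contraTneq vR => ->; rewrite inE fR.
have wf : w != f by apply: contraTneq wR => ->; rewrite inE fR.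
have vw : v != w by apply: contra_not_neq fvw => ->.
have uvw : unres v w.
  split; first exact/eqP.
  by move=> r; rewrite !inE => /andP[rf rR']; have := gvw r rf; rewrite rR'.
have Evw p q : (p, q) \in E -> (p = v /\ q = w) \/ (p = w /\ q = v).
  move=> pq; have wvE : (w, v) \in E by apply: unresE => //; apply: usym.
  have EE : [set (v, w); (w, v)] = E.
    apply/eqP; rewrite eqEcard subUset !sub1set vwE wvE.
    by rewrite cards2 xpair_eqE negb_and vw.
  by move: pq; rewrite -EE !inE !xpair_eqE => /orP[]/andP[/eqP-> /eqP->]; [left|right].
(* The only edge joins [v] and [w] and cannot be equidistant from one of its own ends, so the pair
   surviving the exchange for [x] contains [f]. *)
have partner x : x = v \/ x = w ->
    exists u, [/\ unres u f, u != f, u != x & gdist e u x = gdist e f x].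
  move=> xvw; have xf : x != f by case: xvw => ->.
  have [u [y [uy ux uf unx]]] := step x xf.
  have [yf|yf] := eqVneq y f; first by exists u; split=> //; rewrite -yf.
  exfalso; have := resf _ _ uy; case: (Evw _ _ (unresE _ _ uf yf uy)) => -[pu py].
    subst u y; case: xvw => xx; first by rewrite xx eqxx in unx.
    by move/eqP: ux; rewrite xx dxx gdist_eq0 (negPf vw).
  subst u y; case: xvw => xx; last by rewrite xx eqxx in unx.
  by move/eqP: ux; rewrite xx dxx gdist_eq0 eq_sym (negPf vw).
have [u [uuf uf uv duv]] := partner v (or_introl erefl).
have [u' [uuf' uf' uw' duw']] := partner w (or_intror erefl).
(* Distinct partners form the edge, so [u] is [w] and [u'] is [v]; both are then at distance
   [gdist e v w] from each other and from [f], so [f] does not separate [v] from [w]. *)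
have [uu'|uu'] := eqVneq u u'; last first.
  have : unres u u' by apply: utrans uuf _; [apply/eqP | apply: usym].
  move/(unresE _ _ uf uf')/Evw => [] [pu pu']; first by rewrite pu eqxx in uv.
  apply: fvw; move: duv duw'; rewrite pu pu' => dwv dvw.
  by rewrite (gdist_sym v) (gdist_sym w) -dwv -dvw gdist_sym.
subst u'.
(* A common partner [u] is tried as a replacement. A new partner of [f] would give an edge at [u],
   so the surviving pair is [v], [w]; equidistant from [u], they are equidistant from [f]. *)
have [p [q [pq dpq pf pu]]] := step u uf.
have [qf|qf] := eqVneq q f.
  have : unres p u by apply: utrans pq _; [apply/eqP | rewrite qf; apply: usym].
  by move/(unresE _ _ pf uf)/Evw => [] [_ uE]; [rewrite uE eqxx in uw' | rewrite uE eqxx in uv].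
apply: fvw; rewrite (gdist_sym v) (gdist_sym w) -duv -duw' !(gdist_sym u).
by case: (Evw _ _ (unresE _ _ pf qf pq)) => -[pE qE]; rewrite -pE -qE.
Qed.

(** * Counting forced vertices *)

Lemma bf_bound R :
    1 < #|T| -> metric_basis e R -> 0 < bf e ->
  [/\ [set f | basis_forced e f] \subset R & 3 * bf e + 2 <= 2 * (#|T| - #|R|)].
Proof.
move=> T2 bR /card_gt0P[f0]; rewrite inE => fF0; split.
  by apply/subsetP=> f; rewrite inE => /forallP/(_ R)/implyP; apply.
have sepR : separated (code R) (~: R) by apply: separated_code; case/andP: bR.
have -> : #|T| - #|R| = #|~: R| by rewrite -(cardsC R) addKn.
(* The bound needs a nonempty complement of [R]; the edges of the colour [f0] supply it. *)
apply: leq_trans (sum_weight_bound sepR _); last first.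
  have := forced_weight T2 bR fF0; apply: contra_eqN => /eqP ->.
  by rewrite /weight (_ : code_edges _ _ _ = set0) ?cards0 //; apply/setP=> p; rewrite !inE.
rewrite leq_add2r (bigID (basis_forced e)) /=; apply: leq_trans (leq_addr _ _).
rewrite (eq_bigr (fun=> 3)) => [|f]; last exact: forced_weight.
by rewrite sum_nat_const mulnC /bf cardsE.
Qed.

End ForcedVertices.

Theorem corollary8 (T : finType) (e : rel T) (n : nat) :
  simple_graph e -> connected_graph e -> #|T| = n -> 2 <= n ->
  bf e <= (2 * (n - 1)) %/ 5 /\
  (bf e = (2 * (n - 1)) %/ 5 ->
   n = 1 %[mod 5] \/ n = 4 %[mod 5] ->
   exists! R : {set T}, metric_basis e R).
Proof.
move=> [sym_e _] _ Tn n2; rewrite -Tn in n2 *.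
have [R0 bR0] := exists_metric_basis e.
have [bf0|bf0] := posnP (bf e).
  (* With [n >= 2], the two residues force [n >= 4], so the upper bound is positive and 0 does not
     attain it. *)
  by split; [rewrite bf0 | rewrite bf0; lia].
have bound R bR := @bf_bound T e sym_e R n2 bR bf0.
have leT (R : {set T}) : #|R| <= #|T| := max_card _.
have sub_bf R : metric_basis e R -> bf e <= #|R|.
  by move=> /bound[/subset_leq_card].
split.
  have [_ b] := bound R0 bR0; have := sub_bf R0 bR0; have := leT R0; lia.
move=> bfE modn; exists R0; split=> //.
suff forcedE R : metric_basis e R -> R = [set f | basis_forced e f].
  by move=> R bR; rewrite (forcedE R0) // -(forcedE R).
move=> bR; have [sub b] := bound R bR; apply/esym/eqP.
(* A basis with more than [bf e] elements would give [5 * bf e + 2 <= 2 * (n - 1)], but at equality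
   the remainder of [2 * (n - 1)] modulo 5 is 0 or 1 in these classes. *)
rewrite eqEcard sub -/(bf e) /=; have := leT R; move: bfE modn b; lia.
Qed.
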